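(* Let $G(s)$ be a square real-rational proper transfer function matrix. Then $G(s)$ is lossless negative imaginary if and only if (1) $G(\infty)=G^{T}(\infty)$; and (2) $F(s)=s[G(s)-G(\infty)]$ is lossless positive real.
   Context: $A^{T}$ and $A^{*}$ denote the transpose and complex conjugate transpose of a matrix. $G(\infty)=\lim_{s\to\infty}G(s)$, which exists since $G$ is proper. A square transfer function matrix $F(s)$ is positive real if: all elements of $F(s)$ are analytic in $\mathrm{Re}[s]>0$; $F(s)$ is real for real positive $s$; and $F^{*}(s)+F(s)\ge 0$ for $\mathrm{Re}[s]>0$. A square real-rational $F(s)$ is lossless positive real if it is positive real and $F(j\omega)+F^{*}(j\omega)=0$ for all $\omega>0$ except values of $\omega$ where $j\omega$ is a pole of $F(s)$. A square real-rational transfer function matrix $G(s)$ (a square matrix of rational functions with real coefficients) is negative imaginary if: (i) $G(s)$ has no poles in $\mathrm{Re}[s]>0$; (ii) $j[G(j\omega)-G^{*}(j\omega)]\ge 0$ for all $\omega>0$ except values of $\omega$ where $j\omega$ is a pole of $G(s)$; (iii) if $s=0$ is a pole of $G(s)$, then it is at most a double pole, $\lim_{s\to 0}s^{2}G(s)$ is positive semidefinite Hermitian, and $\lim_{s\to 0}s^{m}G(s)=0$ for all $m\ge 3$; (iv) if $s=j\omega_0$ with $\omega_0>0$ finite is a pole of $G(s)$, it is at most a simple pole and $K=\lim_{s\to j\omega_0}(s-j\omega_0)jG(s)$ is positive semidefinite Hermitian; (v) if $s=j\infty$ is a pole of $G(s)$, then it is at most a double pole, $\lim_{\omega\to\infty}G(j\omega)/(j\omega)^2$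 is negative semidefinite Hermitian, and $\lim_{\omega\to\infty}G(j\omega)/(j\omega)^m=0$ for all $m\ge 3$. A square real-rational $G(s)$ is lossless negative imaginary if it is negative imaginary and $j[G(j\omega)-G^{*}(j\omega)]=0$ for all $\omega>0$ except values of $\omega$ where $j\omega$ is a pole of $G(s)$. *)

(* Defs.v *)
From HB Require Import structures.
From mathcomp Require Import all_boot all_order all_algebra.
From mathcomp Require Import complex.
From mathcomp Require Import all_classical all_reals all_analysis.
Import Order.TTheory GRing.Theory Num.Theory.
Import numFieldNormedType.Exports.
Set Implicit Arguments.
Unset Strict Implicit.
Unset Printing Implicit Defensive.
Local Open Scope classical_set_scope.
Local Open Scope ring_scope.
Local Open Scope complex_scope.
Local Open Scope sesquilinear_scope.

(* The library puts the norm topology on an abstract numClosedFieldType but not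
   on R[i]; these instances select the same structures, those of R[i]^o. *)
HB.instance Definition _ (R : rcfType) :=
  PseudoPointedMetric.copy R[i] R[i]^o.
HB.instance Definition _ (R : rcfType) := GRing.ComAlgebra.copy R[i] R[i]^o.
HB.instance Definition _ (R : rcfType) := Vector.copy R[i] R[i]^o.
HB.instance Definition _ (R : rcfType) := NormedModule.copy R[i] R[i]^o.

(* Filter of the neighbourhoods of the point at infinity of the complex
   plane. *)
Definition cinfty (R : realType) : set_system R[i] :=
  [set P | exists M : R, forall s : R[i], M%:C < `|s| -> P s].

Arguments cinfty R : clear implicits.

Global Instance cinfty_filter (R : realType) : ProperFilter (cinfty R).
Proof.
split; last split.
- by case=> M /(_ (`|M| + 1)%:C); apply; rewrite normc_def /= expr0n addr0
    sqrtr_sqr ltcR (lt_le_trans _ (ler_norm _))// (le_lt_trans (ler_norm _))//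
    ltrDl.
- by exists 0.
- move=> P Q [M hM] [N hN]; exists (Num.max M N) => s hs.
  split; [apply: hM|apply: hN]; apply: le_lt_trans hs; rewrite lecR le_max lexx//.
  by rewrite orbT.
- by move=> P Q PQ [M hM]; exists M => s /hM /PQ.
Qed.

(* Real-rational functions are elements of the field {fraction {poly R}}.  The
   representative of a fraction need not be in lowest terms, so common factors
   are divided out before poles are read off and before evaluation. *)
Definition numer (R : realType) (f : {fraction {poly R}}) : {poly R} :=
  let r := frac (repr f) in r.1 %/ gcdp r.1 r.2.

Definition denom (R : realType) (f : {fraction {poly R}}) : {poly R} :=
  let r := frac (repr f) in r.2 %/ gcdp r.1 r.2.

(* At a pole the value is 0, since 0^-1 = 0; f is unbounded nearby, so this does
   not make it continuous or derivable there. *)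
Definition feval (R : realType) (f : {fraction {poly R}}) (s : R[i]) : R[i] :=
  (map_poly (real_complex R) (numer f)).[s] /
  (map_poly (real_complex R) (denom f)).[s].

Definition mxeval (R : realType) (n : nat) (G : 'M[{fraction {poly R}}]_n)
  (s : R[i]) : 'M[R[i]]_n := map_mx (fun f => feval f s) G.

(* Order of s as a pole of G: the largest order over the entries of G, and 0
   when s is not a pole. *)
Definition pole_order (R : realType) (n : nat)
    (G : 'M[{fraction {poly R}}]_n) (s : R[i]) : nat :=
  \max_(i < n) \max_(j < n) mup s (map_poly (real_complex R) (denom (G i j))).

Definition is_pole (R : realType) (n : nat)
  (G : 'M[{fraction {poly R}}]_n) (s : R[i]) : Prop := (0 < pole_order G s)%N.

(* Order of the pole at infinity; the subtraction is truncated. *)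
Definition pole_order_infty (R : realType) (n : nat)
    (G : 'M[{fraction {poly R}}]_n) : nat :=
  \max_(i < n) \max_(j < n) (size (numer (G i j)) - size (denom (G i j)))%N.

Definition is_pole_infty (R : realType) (n : nat)
  (G : 'M[{fraction {poly R}}]_n) : Prop := (0 < pole_order_infty G)%N.

Definition is_proper (R : realType) (n : nat)
    (G : 'M[{fraction {poly R}}]_n) : Prop :=
  forall i j, (size (numer (G i j)) <= size (denom (G i j)))%N.

(* G(oo).  When G is proper this limit exists and, the coefficients being real,
   is a real matrix; get then picks it and never its default value. *)
Definition at_infty (R : realType) (n : nat)
    (G : 'M[{fraction {poly R}}]_n) : 'M[R]_n :=
  get [set D : 'M[R]_n |
        mxeval G s @[s --> cinfty R] --> map_mx (real_complex R) D].

Definition sG_sub_infty (R : realType) (n : nat)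
    (G : 'M[{fraction {poly R}}]_n) : 'M[{fraction {poly R}}]_n :=
  (tofrac 'X : {fraction {poly R}}) *:
    (G - map_mx (fun c : R => tofrac c%:P) (at_infty G)).

Definition psd (R : realType) (n : nat) (A : 'M[R[i]]_n) : Prop :=
  A^t* = A /\ forall v : 'cV[R[i]]_n, 0 <= (v^t* *m A *m v) 0 0.

Definition nsd (R : realType) (n : nat) (A : 'M[R[i]]_n) : Prop :=
  psd (- A).

(* Analyticity is complex differentiability at every point of the open right
   half-plane: derivable is taken over the field R[i], so the increment in the
   difference quotient is complex. *)
Definition positive_real (R : realType) (n : nat) (F : R[i] -> 'M[R[i]]_n)
    : Prop :=
  [/\ forall i j (s : R[i]), 0 < complex.Re s ->
        derivable (fun z : R[i] => F z i j) s 1,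
      forall x : R, 0 < x -> forall i j, F x%:C i j \is Num.real
    & forall s : R[i], 0 < complex.Re s -> psd ((F s)^t* + F s)].

Definition lossless_positive_real (R : realType) (n : nat)
    (F : 'M[{fraction {poly R}}]_n) : Prop :=
  positive_real (mxeval F) /\
  forall w : R, 0 < w -> ~ is_pole F (w *i) ->
    mxeval F (w *i) + (mxeval F (w *i))^t* = 0.

Definition negative_imaginary (R : realType) (n : nat)
    (G : 'M[{fraction {poly R}}]_n) : Prop :=
  [/\ forall s : R[i], 0 < complex.Re s -> ~ is_pole G s,
      forall w : R, 0 < w -> ~ is_pole G (w *i) ->
        psd ('i%C *: (mxeval G (w *i) - (mxeval G (w *i))^t*)),
      is_pole G 0%R ->
        [/\ (pole_order G 0%R <= 2)%N,
            exists2 K : 'M[R[i]]_n,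
              (s ^+ 2 *: mxeval G s) @[s --> (0 : R[i])^'] --> K & psd K
          & forall m, (3 <= m)%N ->
              (s ^+ m *: mxeval G s) @[s --> (0 : R[i])^'] -->
                (0 : 'M[R[i]]_n)],
      forall w0 : R, 0 < w0 -> is_pole G (w0 *i) ->
        (pole_order G (w0 *i) <= 1)%N /\
        exists2 K : 'M[R[i]]_n,
          ((s - w0 *i) *: ('i%C *: mxeval G s)) @[s --> (w0 *i : R[i])^'] --> K
          & psd K
    & is_pole_infty G ->
        [/\ (pole_order_infty G <= 2)%N,
            exists2 K : 'M[R[i]]_n,
              ((w *i) ^- 2 *: mxeval G (w *i)) @[w --> (+oo : set_system R)]
                --> K & nsd K
          & forall m, (3 <= m)%N ->
              ((w *i) ^- m *: mxeval G (w *i)) @[w --> (+oo : set_system R)]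
                --> (0 : 'M[R[i]]_n)]].

Definition lossless_negative_imaginary (R : realType) (n : nat)
    (G : 'M[{fraction {poly R}}]_n) : Prop :=
  negative_imaginary G /\
  forall w : R, 0 < w -> ~ is_pole G (w *i) ->
    'i%C *: (mxeval G (w *i) - (mxeval G (w *i))^t*) = 0.

(* Main.v *)
(* Necessity. On the imaginary axis G = G^*, that is G(s) = G(-s)^T, an identity
   between rational functions that excludes poles in Re s < 0 and, at infinity,
   gives the symmetry of G(oo). All poles thus lie on the imaginary axis, and
   conditions (iii)-(iv) make those of F = s(G - G(oo)) simple with positive
   semidefinite residues. For a vector v the proper rational function v^*Fv is
   then c + sum_k r_k/(s - z_k) with r_k >= 0 and Re z_k = 0; since
   Re (v^*Fv) = 0 on the axis, Re c = 0, so Re (v^*Fv) >= 0 on Re s > 0.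

   Sufficiency. At a point z of the axis let A be the limit of (s - z)^m F.
   Letting s tend to z along the ray z + t u, t > 0, gives Re (v^*Av/u^m) >= 0
   whenever Re u > 0. For m > 1 this forces A = 0, so that poles of F on the
   axis are simple, and for m = 1 it says that A is positive semidefinite; this
   gives the conditions on the poles of G = G(oo) + F/s. *)

Require Import Defs.
From mathcomp Require Import all_boot all_order all_algebra.
From mathcomp Require Import complex.
From mathcomp Require Import all_classical all_reals all_analysis.
From mathcomp Require Import ring lra.
Import Order.TTheory GRing.Theory Num.Theory.
Import numFieldNormedType.Exports.
Set Implicit Arguments.
Unset Strict Implicit.
Unset Printing Implicit Defensive.
Local Open Scope classical_set_scope.
Local Open Scope complex_scope.
Local Open Scope sesquilinear_scope.
Local Open Scope ring_scope.

(** * Limits at poles *)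

Section limits.
Context {K : numFieldType} {T : Type} {F : set_system T} {FF : Filter F}.

Lemma cvg_near_eq (U : Type) (G : set_system U) (f g : T -> U) :
  (\forall x \near F, f x = g x) -> f x @[x --> F] `=>` G -> g x @[x --> F] `=>` G.
Proof.
move=> fg; apply: cvg_trans.
by apply: near_eq_cvg; apply: filterS fg => x ->.
Qed.

Lemma cvg_horner (p : {poly K}) (f : T -> K) (a : K) :
  f x @[x --> F] --> a -> p.[f x] @[x --> F] --> p.[a].
Proof.
move=> fa; elim/poly_ind: p => [|p c IH].
  by rewrite horner0; under eq_fun do rewrite horner0; exact: cvg_cst.
rewrite hornerMXaddC; under eq_fun do rewrite hornerMXaddC.
by apply: cvgD; [exact: cvgM|exact: cvg_cst].
Qed.

Lemma cvg_horner_div (p q : {poly K}) (f : T -> K) (a : K) : q.[a] != 0 ->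
  f x @[x --> F] --> a -> p.[f x] / q.[f x] @[x --> F] --> p.[a] / q.[a].
Proof.
move=> qa fa; apply: cvgM; first exact: cvg_horner.
by apply: cvgV => //; exact: cvg_horner.
Qed.

Lemma cvg_exprn (f : T -> K) (a : K) k :
  f x @[x --> F] --> a -> f x ^+ k @[x --> F] --> a ^+ k.
Proof.
by move/(cvg_horner (p := 'X^k)); rewrite hornerXn; under eq_fun do rewrite hornerXn.
Qed.

Lemma cvg_sumr (I : Type) (r : seq I) (P : pred I) (f : I -> T -> K) (a : I -> K) :
  (forall i, P i -> f i x @[x --> F] --> a i) ->
  (\sum_(i <- r | P i) f i x) @[x --> F] --> \sum_(i <- r | P i) a i.
Proof.
move=> h; elim: r => [|i r IH].
  by rewrite big_nil; under eq_fun do rewrite big_nil; exact: cvg_cst.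
rewrite big_cons; under eq_fun do rewrite big_cons.
case: ifPn => // Pi; apply: cvgD => //; exact: h.
Qed.

End limits.

Section punctured.
Context {K : numFieldType}.
Implicit Types (z s : K) (p q : {poly K}).

Lemma dnbhs_cvg z : s @[s --> z^'] --> z.
Proof. exact: (cvg_within (F := nbhs z)). Qed.

Lemma near_dnbhs_neq z : \forall s \near z^', s != z.
Proof. exact: withinT. Qed.

Lemma near_dnbhs_nonroot p z : p != 0 -> \forall s \near z^', p.[s] != 0.
Proof.
move=> p0; have [m [q]] := multiplicity_XsubC p z; rewrite p0 /= => qz ->.
have cq : q.[s] @[s --> z^'] --> q.[z] by apply: cvg_horner; exact: dnbhs_cvg.
near=> s; rewrite hornerM horner_exp hornerXsubC mulf_neq0 //.
- by near: s; apply: (cvgr_neq0 _ cq).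
- by rewrite expf_neq0 // subr_eq0; near: s; exact: near_dnbhs_neq.
Unshelve. all: by end_near. Qed.

(** Cancelling the factor (s - z)^k of [q], where k <= m, leaves (s - z)^(m - k) p/u with u(z)
    nonzero, which is continuous at [z]. *)
Lemma mup_cvg p q z m : q != 0 -> (mup z q <= m)%N ->
  exists l : K, (s - z) ^+ m * (p.[s] / q.[s]) @[s --> z^'] --> l.
Proof.
move=> q0; rewrite mup_leq//.
have [k [u]] := multiplicity_XsubC q z; rewrite q0 /= => uz ->.
case: (leqP k m) => [km _|mk]; last by rewrite dvdp_mull ?dvdp_exp2l.
(* The factor (z - z)^(m - k) is 1 when k = m and 0 when k < m, so one witness serves both cases. *)
exists ((z - z) ^+ (m - k) * p.[z] / u.[z]).
apply: (cvg_near_eq (f := fun s => (s - z) ^+ (m - k) * p.[s] / u.[s])).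
  near=> s; have sz : s - z != 0.
    by rewrite subr_eq0; near: s; exact: near_dnbhs_neq.
  have us : u.[s] != 0.
    by near: s; apply: near_dnbhs_nonroot; apply: contraNneq uz => ->; exact: root0.
  rewrite hornerM horner_exp hornerXsubC -{2}(subnK km) exprD.
  have : (s - z) ^+ k != 0 by rewrite expf_neq0.
  move: (_ ^+ k) (_ ^+ (m - k)) => a b a0.
  by field; rewrite a0 us.
apply: cvgM; last by apply: cvgV => //; apply: cvg_horner; exact: dnbhs_cvg.
apply: cvgM; last by apply: cvg_horner; exact: dnbhs_cvg.
by apply: cvg_exprn; apply: cvgB; [exact: dnbhs_cvg|exact: cvg_cst].
Unshelve. all: by end_near. Qed.

(** With q = u (X - z)^m, multiplying the function by u gives back p. A zero limit would therefore
    make [z] a common root of [p] and [q], against coprimality. *)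
Lemma cvg_mup_neq0 p q z m (l : K) : coprimep p q -> q != 0 ->
  (0 < m <= mup z q)%N ->
  (s - z) ^+ m * (p.[s] / q.[s]) @[s --> z^'] --> l -> l != 0.
Proof.
move=> pq q0 /andP[m0]; rewrite mup_geq // => /dvdpP[u Eq] h.
have qz : root q z by rewrite Eq rootM -(prednK m0) root_exp_XsubC eqxx orbT.
apply: contraL (qz) => /eqP l0; rewrite l0 in h.
suff pz : root p z by exact: (coprimep_root pq).
have h1 : p.[s] @[s --> z^'] --> 0 * u.[z].
  apply: (cvg_near_eq (f := fun s => (s - z) ^+ m * (p.[s] / q.[s]) * u.[s])).
    near=> s; have qs : q.[s] != 0 by near: s; exact: near_dnbhs_nonroot.
    rewrite (_ : _ * _ * _ = p.[s] / q.[s] * (u.[s] * (s - z) ^+ m)); last by ring.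
    rewrite (_ : u.[s] * _ = q.[s]) ?divfK// Eq.
    by rewrite hornerM horner_exp hornerXsubC.
  by apply: cvgM => //; apply: cvg_horner; exact: dnbhs_cvg.
rewrite mul0r in h1; apply/rootP.
by apply: (cvg_unique _ _ h1) => //; apply: cvg_horner; exact: dnbhs_cvg.
Unshelve. all: by end_near. Qed.

(** If the order exceeded [m], one more factor s - z would still leave a nonzero limit by
    [cvg_mup_neq0], whereas that limit is (z - z) l = 0. *)
Lemma cvg_mup_le p q z m (l : K) : coprimep p q -> q != 0 ->
  (s - z) ^+ m * (p.[s] / q.[s]) @[s --> z^'] --> l -> (mup z q <= m)%N.
Proof.
move=> pq q0 h; rewrite leqNgt; apply/negP => mq.
suff /eqP : (0 : K) != 0 by [].
apply: (@cvg_mup_neq0 p q z m.+1 0 pq q0 mq).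
have <- : (z - z) * l = 0 by rewrite subrr mul0r.
under eq_fun do rewrite exprS -mulrA.
by apply: cvgM => //; apply: cvgB; [exact: dnbhs_cvg|exact: cvg_cst].
Qed.

End punctured.

(** * Proper functions with simple poles on the imaginary axis *)

Section simple_poles.
Context {K : numClosedFieldType}.
Implicit Types (s z r : K) (p q : {poly K}).

Lemma Re_div_real r x : r \is Num.real -> 'Re (r / x) = r * `|x| ^- 2 * 'Re x.
Proof. by move=> rR; rewrite ReMl// invC_norm ReMl ?Re_conj ?mulrA// realV realX// normr_real. Qed.

(* Peel off one root z of q at a time: p/q - r/(s - z), with r the residue of
   p/q at z, has a denominator of smaller degree and inherits the hypotheses,
   while Re (r/(s - z)) has the sign of Re s. *)
Lemma Re_ge0_simple_poles p q (w : K) : q != 0 -> (size p <= size q)%N ->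
  (forall z, exists2 r, (s - z) * (p.[s] / q.[s]) @[s --> z^'] --> r &
     0 <= r /\ (r != 0 -> 'Re z = 0)) ->
  'Re w = 0 -> q.[w] != 0 -> 'Re (p.[w] / q.[w]) = 0 ->
  forall s, 0 < 'Re s -> q.[s] != 0 -> 0 <= 'Re (p.[s] / q.[s]).
Proof.
have [n] := ubnP (size q); elim: n => // n IH in p q *.
rewrite ltnS => qn q0 pq hlim w0 qw pqw s s0 qs.
(* A constant [q] forces [p] to be constant, so the value at [s] is the value at [w], whose real
   part is 0. *)
have [/eqP|sq1] := eqVneq (size q) 1%N.
  move=> sq; have := sq; rewrite size_poly_eq1 => /eqpP sqq.
  have /size1_polyC Eq : (size q <= 1)%N by rewrite (eqP sq).
  have /size1_polyC Ep : (size p <= 1)%N by rewrite -(eqP sq).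
  by rewrite -pqw Eq Ep !hornerC.
have /closed_rootP[z] := sq1; rewrite -/(is_true _) => /factor_theorem[u Eq].
have u0 : u != 0 by apply: contraNneq q0 => u0; rewrite Eq u0 mul0r.
have [r hr [r0 rz]] := hlim z.
have sqE : size q = (size u).+1.
  by rewrite Eq size_Mmonic ?monicXsubC// size_XsubC addn2.
have Eqs x : q.[x] = u.[x] * (x - z) by rewrite Eq hornerM hornerXsubC.
(* Near [z] the polynomial p - r u equals ((s - z) p/q - r) u, which tends to 0; hence [z] is a
   root. *)
have /factor_theorem[p' Ep'] : root (p - r *: u) z.
  apply/rootP.
  have h1 : (p - r *: u).[s] @[s --> z^'] --> (r - r) * u.[z].
    apply: (cvg_near_eq (f := fun s => ((s - z) * (p.[s] / q.[s]) - r) * u.[s])).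
      near=> x.
      have us : u.[x] != 0 by near: x; exact: near_dnbhs_nonroot.
      have xz : x - z != 0 by rewrite subr_eq0; near: x; exact: near_dnbhs_neq.
      by rewrite hornerD hornerN hornerZ Eqs; field; rewrite xz us.
    apply: cvgM; first by apply: cvgB => //; exact: cvg_cst.
    by apply: cvg_horner; exact: dnbhs_cvg.
  rewrite subrr mul0r in h1.
  by apply: (cvg_unique _ _ h1) => //; apply: cvg_horner; exact: dnbhs_cvg.
have Efr x : q.[x] != 0 -> p.[x] / q.[x] = p'.[x] / u.[x] + r / (x - z).
  rewrite Eqs mulf_eq0 negb_or => /andP[ux xz].
  have : (p - r *: u).[x] = p'.[x] * (x - z) by rewrite Ep' hornerM hornerXsubC.
  rewrite hornerD hornerN hornerZ => /eqP; rewrite subr_eq => /eqP ->.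
  by field; rewrite ux xz.
have qu x : q.[x] != 0 -> u.[x] != 0 by rewrite Eqs mulf_eq0 negb_or => /andP[].
have rR : r \is Num.real by exact: ger0_real.
have Rer x : 'Re (r / (x - z)) = r * `|x - z| ^- 2 * 'Re x.
  have [->|/rz Rez] := eqVneq r 0; first by rewrite !mul0r raddf0.
  by rewrite Re_div_real// raddfB /= Rez subr0.
rewrite Efr// raddfD /= addr_ge0//; last first.
  by rewrite Rer !mulr_ge0// ?invr_ge0 ?exprn_ge0// ltW.
apply: IH => //; [by rewrite -sqE| | | exact: qu | | exact: qu].
- have [->|p'0] := eqVneq p' 0; first by rewrite size_poly0.
  have := size_Mmonic p'0 (monicXsubC z); rewrite -Ep' size_XsubC addn2 /= => E.
  rewrite -ltnS -E -sqE (leq_trans (size_polyD _ _))// geq_max pq size_polyN.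
  by rewrite (leq_trans (size_scale_leq _ _))// sqE.
- move=> z'; have [Ez|zz'] := eqVneq z' z.
    (* [p] and [q] may have common roots, so [z] can still be a root of [u]; the new residue there
       is r - r = 0. *)
    exists 0; last by rewrite eqxx.
    rewrite {}Ez -[X in _ --> X](subrr r).
    apply: (cvg_near_eq (f := fun s => (s - z) * (p.[s] / q.[s]) - r)).
      near=> x.
      have qx : q.[x] != 0 by near: x; exact: near_dnbhs_nonroot.
      have xz : x - z != 0 by rewrite subr_eq0; near: x; exact: near_dnbhs_neq.
      by rewrite Efr// mulrDr [_ * (r / _)]mulrC divfK// addrK.
    by apply: cvgB => //; exact: cvg_cst.
  (* The removed term r/(s - z) is continuous at z' != z, so the residue at z' does not change. *)
  have [r' hr' ?] := hlim z'; exists r' => //.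
  rewrite -[X in _ --> X]subr0 -[X in _ - X](mul0r (r / (z' - z))) -(subrr z').
  apply: (cvg_near_eq (f := fun s => (s - z') * (p.[s] / q.[s]) - (s - z') * (r / (s - z)))).
    near=> x.
    have qx : q.[x] != 0 by near: x; exact: near_dnbhs_nonroot.
    by rewrite Efr// mulrDr addrK.
  apply: cvgB => //; apply: cvgM.
    by apply: cvgB; [exact: dnbhs_cvg|exact: cvg_cst].
  apply: cvgM; first exact: cvg_cst.
  apply: cvgV; first by rewrite subr_eq0.
  by apply: cvgB; [exact: dnbhs_cvg|exact: cvg_cst].
- have := pqw; by rewrite Efr// raddfD /= Rer w0 mulr0 addr0.
Unshelve. all: by end_near. Qed.

End simple_poles.

(** * Evaluation of real-rational functions *)

(** Gives access to a fraction through its representative by field operations; equality of the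
    classes is checked by cross-multiplication. *)
Lemma pi_fraction (A : idomainType) (x : {ratio A}) :
  \pi_({fraction A})%qT x = tofrac (frac x).1 / tofrac (frac x).2.
Proof.
have d0 : tofrac (frac x).2 != 0 :> {fraction A} by rewrite tofrac_eq0 denom_ratioP.
apply: (mulIf d0); rewrite divfK//; unlock tofrac.
rewrite -[LHS]FracField.pi_mul; apply/eqmodP; rewrite /= FracField.equivfE /FracField.mulf.
by rewrite !numden_Ratio ?mulf_neq0 ?oner_eq0 ?denom_ratioP// !mulr1 mulrC.
Qed.

Section rational_functions.
Context {R : realType}.
Implicit Types (f : {fraction {poly R}}) (a b : {poly R}) (s z : R[i]).

Lemma denom_neq0 f : denom f != 0.
Proof.
rewrite /denom dvdp_div_eq0 ?dvdp_gcdr//; exact: denom_ratioP.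
Qed.

Lemma coprime_numer_denom f : coprimep (numer f) (denom f).
Proof. by apply: coprimep_div_gcd; rewrite (denom_ratioP (repr f)) orbT. Qed.

Lemma fraction_numer_denom f : f = tofrac (numer f) / tofrac (denom f).
Proof.
have d0 := denom_ratioP (repr f).
have g0 : gcdp (frac (repr f)).1 (frac (repr f)).2 != 0 by rewrite gcdp_eq0 (negPf d0) andbF.
transitivity (tofrac (frac (repr f)).1 / tofrac (frac (repr f)).2).
  by rewrite -pi_fraction reprK.
have gn := dvdp_gcdl (frac (repr f)).1 (frac (repr f)).2.
have gd := dvdp_gcdr (frac (repr f)).1 (frac (repr f)).2.
rewrite /numer /denom; move: (gcdp _ _) gn gd g0 => g gn gd g0.
rewrite -{1}(divpK gn) -{1}(divpK gd) !tofracM -mulf_div divff ?mulr1//.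
by rewrite tofrac_eq0.
Qed.

Lemma numer_denom_cross f a b : b != 0 -> f = tofrac a / tofrac b ->
  numer f * b = a * denom f.
Proof.
move=> b0; rewrite [in LHS](fraction_numer_denom f) => /eqP.
rewrite eqr_div ?tofrac_eq0 ?denom_neq0// -!tofracM tofrac_eq => /eqP ->.
by [].
Qed.

Local Notation toC := (map_poly (real_complex R)).

Lemma denomC_neq0 f : toC (denom f) != 0.
Proof. by rewrite map_poly_eq0 denom_neq0. Qed.

Lemma coprime_numerC_denomC f : coprimep (toC (numer f)) (toC (denom f)).
Proof. by rewrite coprimep_map coprime_numer_denom. Qed.

(** Allows evaluation without reducing to lowest terms. By Gauss's lemma the reduced denominator
    divides [b], so it does not vanish at [s] either, and cross-multiplication applies. *)
Lemma feval_frac f a b s : f = tofrac a / tofrac b -> (toC b).[s] != 0 ->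
  feval f s = (toC a).[s] / (toC b).[s].
Proof.
move=> fab bs.
have b0 : b != 0 by apply: contraNneq bs => ->; rewrite rmorph0 horner0.
have E := numer_denom_cross b0 fab.
have ds : (toC (denom f)).[s] != 0.
  have : denom f %| b.
    rewrite -(@Gauss_dvdpr _ _ (numer f)) 1?coprimep_sym ?coprime_numer_denom//.
    by rewrite E dvdp_mull.
  by move=> /dvdpP[c Ec]; apply: contraNneq bs => h; rewrite Ec rmorphM hornerM h mulr0.
apply/eqP; rewrite /feval eqr_div//.
by rewrite -!hornerM -!rmorphM E.
Qed.

Lemma horner_conj (a : {poly R}) s : (toC a).[s^*] = (toC a).[s]^*.
Proof.
rewrite -(horner_map (@conjc R)); congr horner.
by rewrite -map_poly_comp; apply: eq_map_poly => x; rewrite /= oppr0.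
Qed.

Lemma feval_conj f s : feval f (s^*)%R = ((feval f s)^*)%R.
Proof. by rewrite /feval !horner_conj rmorphM fmorphV. Qed.

Lemma near_dnbhs_denom f z : \forall s \near z^', (toC (denom f)).[s] != 0.
Proof. by apply: near_dnbhs_nonroot; exact: denomC_neq0. Qed.

Lemma cvg_feval f (T : Type) (F : set_system T) {FF : Filter F} (u : T -> R[i]) z :
  (toC (denom f)).[z] != 0 -> u x @[x --> F] --> z ->
  feval f (u x) @[x --> F] --> feval f z.
Proof.
exact: cvg_horner_div. Qed.

End rational_functions.

Lemma cvg_mx_entry (K : numFieldType) (T : Type) (F : set_system T) {FF : Filter F}
    (m n : nat) (f : T -> 'M[K]_(m, n)) (A : 'M[K]_(m, n)) :
  (forall i j, f x i j @[x --> F] --> A i j) -> f x @[x --> F] --> A.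
Proof.
move=> h U [P hP PU]; rewrite /nbhs /=.
have : F [set x | forall i j, P i j (f x i j)].
  apply: filter_forall => i; apply: filter_forall => j.
  by apply: h; exact: hP.
by apply: filterS => x /PU.
Qed.

Lemma cvg_entry_mx (K : numFieldType) (T : Type) (F : set_system T) {FF : Filter F}
    (m n : nat) (f : T -> 'M[K]_(m, n)) (A : 'M[K]_(m, n)) i j :
  f x @[x --> F] --> A -> f x i j @[x --> F] --> A i j.
Proof.
by move=> h; exact: (cvg_comp f (fun M : 'M[K]_(m, n) => M i j) h (@coord_continuous K m n i j A)).
Qed.

(** * Polynomials and their quotients along a filter tending to infinity *)

Section infinity.
Context {K : numFieldType} {T : Type} {F : set_system T} {FF : Filter F}.
Variable u : T -> K.
Hypotheses (u0 : \forall x \near F, u x != 0) (uV : (u x)^-1 @[x --> F] --> 0).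

(* p(s) = s^k r(1/s), where r is p with its coefficients reversed. *)
Lemma cvg_horner_expr (p : {poly K}) k : (size p <= k.+1)%N ->
  p.[u x] / u x ^+ k @[x --> F] --> p`_k.
Proof.
move=> pk; pose r := \poly_(i < k.+1) p`_(k - i).
have <- : r.[0] = p`_k by rewrite horner_coef0 coef_poly subn0.
apply: (cvg_near_eq (f := fun x => r.[(u x)^-1])); last exact: cvg_horner.
apply: filterS u0 => x ux; rewrite horner_poly (horner_coef_wide _ pk) mulr_suml.
rewrite (reindex_inj rev_ord_inj) /=; apply: eq_bigr => i _.
have ik : (i <= k)%N by rewrite -ltnS.
rewrite subSS subKn// exprVn -mulrA; congr (_ * _).
rewrite (_ : u x ^+ k = u x ^+ (k - i) * u x ^+ i); last by rewrite -exprD subnK.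
by rewrite invfM mulrCA divff ?mulr1// expf_neq0.
Qed.

(** Divided by the power of [u x] of exponent deg q, the value tends to the leading coefficient,
    which is nonzero. *)
Lemma near_horner_neq0 (q : {poly K}) : q != 0 -> \forall x \near F, q.[u x] != 0.
Proof.
move=> q0; have sq : (size q <= (size q).-1.+1)%N by rewrite prednK ?size_poly_gt0.
have := cvgr_neq0 _ (cvg_horner_expr sq); rewrite lead_coef_eq0 => /(_ FF q0).
by apply: filterS => x; apply: contraNneq => ->; rewrite mul0r.
Qed.

(** Numerator and denominator are both divided by u^(deg q). The coefficient of [p] is read at index
    deg q, hence is 0 when deg p < deg q. *)
Lemma cvg_horner_ratio (p q : {poly K}) : q != 0 -> (size p <= size q)%N ->
  p.[u x] / q.[u x] @[x --> F] --> p`_(size q).-1 / lead_coef q.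
Proof.
move=> q0 pq.
have sq : (size q <= (size q).-1.+1)%N by rewrite prednK ?size_poly_gt0.
apply: (cvg_near_eq (f := fun x => p.[u x] / u x ^+ (size q).-1 *
                                 (q.[u x] / u x ^+ (size q).-1)^-1)).
  apply: filterS u0 => x ux; rewrite invfM invrK mulrA mulrAC divfK//.
  exact: expf_neq0.
apply: cvgM; first by apply: cvg_horner_expr; exact: leq_trans sq.
by apply: cvgV; [rewrite lead_coef_eq0|exact: cvg_horner_expr].
Qed.

End infinity.

(** * Limits, conjugation and real parts *)

Section numclosed.
Context {K : numClosedFieldType}.

Lemma cvg_conjC (T : Type) (F : set_system T) {FF : Filter F} (f : T -> K) (a : K) :
  f x @[x --> F] --> a -> ((f x)^*)%R @[x --> F] --> (a^*)%R.
Proof.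
move=> fa; apply/cvgrPdist_lt => e e0.
have := fa; move=> /cvgrPdist_lt/(_ e e0); apply: filterS => x.
by rewrite -rmorphB norm_conjC.
Qed.

(** If ['Re a] were negative, a value [f x] at distance less than [- 'Re a] from [a] would have
    negative real part. *)
Lemma cvg_Re_ge0 (T : Type) (F : set_system T) {FF : ProperFilter F} (f : T -> K) (a : K) :
  f x @[x --> F] --> a -> (\forall x \near F, 0 <= 'Re (f x)) -> 0 <= 'Re a.
Proof.
move=> fa f0; rewrite real_leNgt ?real0 ?Creal_Re//; apply/negP => a0.
have := fa; move=> /cvgrPdist_lt/(_ (- 'Re a)); rewrite oppr_gt0 => /(_ a0) h.
have [x [fx hx]] := filter_ex (filterI f0 h).
have := le_lt_trans (leif_Re_Creal (f x - a)) ; rewrite distrC => /(_ _ hx).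
by rewrite raddfB /= ltrBlDr addNr; apply/negP; rewrite -real_leNgt ?real0 ?Creal_Re.
Qed.

(** On the ray s = z + e u, e > 0, the quotient (s - z)^m g(s) / u^m equals e^m g(s). Its real part
    is nonnegative because e^m is a positive real, and the inequality passes to the limit. *)
Lemma Re_ge0_rays (g : K -> K) (z a u : K) m :
  (s - z) ^+ m * g s @[s --> z^'] --> a ->
  (forall s, 'Re z < 'Re s -> 0 <= 'Re (g s)) ->
  0 < 'Re u -> 0 <= 'Re (a / u ^+ m).
Proof.
move=> ga g0 ru.
have u0 : u != 0 by apply: contraTneq ru => ->; rewrite raddf0 ltxx.
(* In the partial order of [K], 0 < e means that e is real and positive, so this filter runs along a
   ray. *)
have e0 : e @[e --> (0 : K)^'+] --> (0 : K) by exact: cvg_at_right_filter.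
have ez : z + e * u @[e --> (0 : K)^'+] --> z.
  rewrite -[X in _ --> X]addr0 -[X in _ + X](mul0r u).
  by apply: cvgD; [exact: cvg_cst|apply: cvgM => //; exact: cvg_cst].
have epos : \forall e \near (0 : K)^'+, 0 < e by exact: nbhs_right_gt.
have ez' : z + e * u @[e --> (0 : K)^'+] --> z^'.
  move=> P /ez; rewrite /nbhs /=; apply: filterS2 epos => e e0' Pe; apply: Pe.
  by rewrite /= -subr_eq0 addrC addKr mulf_neq0// gt_eqF.
apply: (@cvg_Re_ge0 _ ((0 : K)^'+) _ (fun e => e ^+ m * g (z + e * u))).
  apply: (cvg_near_eq (f := fun e => (z + e * u - z) ^+ m * g (z + e * u) / u ^+ m)).
    near=> e; rewrite addrC addKr exprMn; have := expf_neq0 m u0.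
    by move: (u ^+ m) (e ^+ m) => b c b0; field.
  apply: cvgM; last exact: cvg_cst.
  exact: (cvg_comp (fun e => z + e * u) (fun s => (s - z) ^+ m * g s) ez' ga).
apply: filterS epos => e ep.
have eR : e ^+ m \is Num.real by rewrite rpredX// gtr0_real.
rewrite ReMl// mulr_ge0 ?exprn_ge0 ?(ltW ep)// g0// raddfD /= ltrDl.
by rewrite ReMl ?gtr0_real// mulr_gt0.
Unshelve. all: by end_near. Qed.

End numclosed.

(** * Half-planes and quadratic forms *)

Section angles.

(** Inversion preserves the open right half-plane, so Re (a w) >= 0 for w = 1 + i t with t real. If
    Im a were nonzero, a suitable t would make Re (a w) = Re a - t Im a equal to -1. Hence [a] is
    real, and u = 1 gives its sign. *)
Lemma ge0_half_plane (K : numClosedFieldType) (a : K) :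
  (forall u, 0 < 'Re u -> 0 <= 'Re (a / u)) -> 0 <= a.
Proof.
move=> h; have [Ima|Ima] := eqVneq ('Im a) 0.
  have aR : a \is Num.real by apply/Creal_ImP.
  by have := h 1; rewrite divr1 !(Creal_ReP _ _) ?rpred1 ?ltr01//; exact.
have [t tR tE] : exists2 t : K, t \is Num.real & 'Im a * t = 'Re a + 1.
  exists (('Re a + 1) / 'Im a); last by rewrite mulrC divfK.
  by rewrite rpredM ?realV ?rpredD ?rpred1 ?Creal_Re ?Creal_Im.
pose w := 1 + 'i%R * t.
have Rw : 'Re w = 1 by rewrite Re_rect ?rpred1.
have w0 : w != 0 by apply: contra_eq_neq Rw => ->; rewrite raddf0 eq_sym oner_eq0.
have Rwi : 0 < 'Re w^-1.
  rewrite invC_norm ReMl ?realV ?realX ?normr_real//.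
  by rewrite Re_conj Rw mulr1 invr_gt0 exprn_gt0 ?normr_gt0.
have := h _ Rwi; rewrite invrK.
rewrite {1}[a]Crect mulrDl mulrDr mulr1 -mulrA.
rewrite (_ : _ + _ = ('Re a - 'Im a * t) + 'i%R * ('Re a * t + 'Im a)); last first.
  by rewrite /w; have := sqrCi K; move: ('i%R : K) => i i2; ring: i2.
rewrite Re_rect ?rpredB ?rpredD ?rpredM ?Creal_Re ?Creal_Im//.
by rewrite tE opprD addrA subrr sub0r oppr_ge0 ler10.
Qed.

Context {R : realType}.

Definition cis (t : R) : R[i] := cos t +i* sin t.

Lemma cisD s t : cis (s + t) = cis s * cis t.
Proof. by rewrite /cis cosD sinD; simpc; rewrite [sin s * _ + _]addrC. Qed.

Lemma cis0 : cis 0 = 1.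
Proof. by rewrite /cis cos0 sin0. Qed.

Lemma cisX t m : cis t ^+ m = cis (t *+ m).
Proof. by elim: m => [|m IH]; rewrite ?expr0 ?mulr0n ?cis0// exprS IH -cisD mulrS. Qed.

Lemma cisN t : cis (- t) = (cis t)^-1.
Proof.
have h : cis t * cis (- t) = 1 by rewrite -cisD subrr cis0.
have t0 : cis t != 0 by apply: contra_eq_neq h => ->; rewrite mul0r eq_sym oner_eq0.
by apply: (mulfI t0); rewrite h divff.
Qed.

Lemma Re_gt0E (z : R[i]) : (0 < 'Re z) = (0 < complex.Re z).
Proof. by rewrite -complexRe ltcR. Qed.

Lemma Re_ge0E (z : R[i]) : (0 <= 'Re z) = (0 <= complex.Re z).
Proof. by rewrite -complexRe lecR. Qed.

(* The arguments of the powers u^m with Re u > 0 fill (-m pi/2, m pi/2), which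
   for m > 1 is not contained in any half-plane. *)
Lemma eq0_half_plane_pow (a : R[i]) m : (1 < m)%N ->
  (forall u : R[i], 0 < 'Re u -> 0 <= 'Re (a / u ^+ m)) -> a = 0.
Proof.
move=> m1 h.
have m0 : 0 < m%:R :> R by rewrite ltr0n (leq_trans _ m1).
(* The choice u = e^(-i t/m) gives a / u^m = a e^(i t), and |t/m| < pi/2 ensures Re u > 0. *)
have key t : `|t| < m%:R * (pi / 2) -> 0 <= complex.Re a * cos t - complex.Im a * sin t.
  have tE : t / m%:R *+ m = t by rewrite -mulr_natr divfK ?gt_eqF.
  move=> tm; have := h (cis (- (t / m%:R))).
  rewrite Re_gt0E Re_ge0E cisX mulNrn [cis (- (_ *+ _))]cisN invrK tE.
  rewrite /cis /= cosN.
  have -> : complex.Re (a * (cos t +i* sin t)) = complex.Re a * cos t - complex.Im a * sin t.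
    by case: a {h}.
  apply; apply: cos_gt0_pihalf.
  rewrite -ltr_norml normrM normfV [`|m%:R|]gtr0_norm//.
  by rewrite ltr_pdivrMr// mulrC.
have pi0 := @pi_gt0 R.
have m2 : 2 <= m%:R :> R by rewrite ler_nat.
have mpi : pi <= m%:R * (pi / 2) :> R.
  rewrite (le_trans (y := 2 * (pi / 2)))//; first by rewrite mulrCA divff ?mulr1.
  by rewrite ler_pM2r// divr_gt0.
have h2 : `|pi / 2| < m%:R * (pi / 2) :> R.
  by rewrite gtr0_norm ?divr_gt0// (lt_le_trans _ mpi)//; lra.
(* The angles pi/2 and -pi/2, admissible because m >= 2, give both signs of Im a. *)
have Ima : complex.Im a = 0.
  have := key _ h2; have := key (- (pi / 2)); rewrite normrN => /(_ h2).
  by rewrite cosN sinN cos_pihalf sin_pihalf; lra.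
have hp : `|pi / 4 + pi / 2| < m%:R * (pi / 2) :> R.
  by rewrite gtr0_norm ?addr_gt0 ?divr_gt0// (lt_le_trans _ mpi)//; lra.
(* The angle 0 gives Re a >= 0; the angle 3 pi/4, where the cosine is - sin (pi/4), gives Re a <=
   0. *)
have Rea : complex.Re a = 0.
  have s4 : 0 < sin (pi / 4) :> R.
    by apply: sin_gt0_pi; apply/andP; split; lra.
  have := key 0; have := key _ hp.
  rewrite normr0 mulr_gt0 ?divr_gt0// => h3 /(_ isT); rewrite cos0.
  move: h3; rewrite cosDpihalf Ima mul0r subr0 => h3; nra.
by apply/eqP; rewrite eq_complex /= Ima Rea !eqxx.
Qed.

End angles.

(** * Quadratic forms of complex matrices *)

Section quadratic_form.
Context {K : numClosedFieldType} {n : nat}.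
Implicit Types (A B : 'M[K]_n) (v : 'cV[K]_n).

Definition qform A v : K := (v^t* *m A *m v) 0 0.

Lemma qformE A v : qform A v = \sum_j \sum_i (v i 0)^*%R * A i j * v j 0.
Proof.
rewrite /qform mxE; apply: eq_bigr => j _; rewrite mxE mulr_suml.
by apply: eq_bigr => i _; rewrite !mxE.
Qed.

Lemma qformD A B v : qform (A + B) v = qform A v + qform B v.
Proof. by rewrite /qform mulmxDr mulmxDl mxE. Qed.

Lemma qformZ c A v : qform (c *: A) v = c * qform A v.
Proof. by rewrite /qform -scalemxAr -scalemxAl mxE. Qed.

Lemma qform_conj A v : qform (A^t*) v = (qform A v)^*%R.
Proof.
rewrite !qformE rmorph_sum exchange_big /=; apply: eq_bigr => i _.
rewrite rmorph_sum; apply: eq_bigr => j _; rewrite !mxE !rmorphM /= conjCK.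
by rewrite mulrC mulrA mulrAC.
Qed.

(** Conjugating the vector compensates for the transposition, so semidefiniteness passes to the
    transpose. *)
Lemma qform_tr A v : qform A^T v = qform A (\col_i (v i 0)^*%R).
Proof.
rewrite !qformE exchange_big /=; apply: eq_bigr => i _; apply: eq_bigr => j _.
by rewrite !mxE conjCK; ring.
Qed.

Lemma trmxC_delta (i : 'I_n) : (delta_mx i 0 : 'cV[K]_n)^t* = delta_mx 0 i.
Proof.
by apply/matrixP => k l; rewrite !mxE andbC; case: (_ && _); rewrite ?conjC1 ?conjC0.
Qed.

(** Polarization: the value at u + v gives b(u,v) + b(v,u) = 0, and replacing v by i v gives b(u,v)
    - b(v,u) = 0. Hence b vanishes, in particular on basis vectors. *)
Lemma qform_eq0 A : (forall v, qform A v = 0) -> A = 0.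
Proof.
move=> A0; pose b (u v : 'cV[K]_n) : K := (u^t* *m A *m v) 0 0.
have bD u v : b u v + b v u = 0.
  have E : (u + v)^t* = u^t* + v^t* by apply/matrixP => k l; rewrite !mxE rmorphD.
  have addE (X Y : 'M[K]_1) : (X + Y) 0 0 = X 0 0 + Y 0 0 by rewrite mxE.
  have := A0 (u + v); rewrite {1}/qform E !mulmxDl !mulmxDr !addE.
  by rewrite -/(qform A u) -/(qform A v) !A0 add0r addr0.
have bil u v : b u ('i%R *: v) = 'i%R * b u v.
  by rewrite /b -scalemxAr mxE.
have bir u v : b ('i%R *: v) u = - 'i%R * b v u.
  rewrite /b (_ : ('i%R *: v)^t* = - 'i%R *: v^t*) -?scalemxAl ?mxE//.
  by apply/matrixP => k l; rewrite !mxE rmorphM /= conjCi.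
have b0 u v : b u v = 0.
  have := bD u ('i%R *: v); rewrite bil bir mulNr -mulrBr => /eqP.
  rewrite mulf_eq0 (negPf (neq0Ci K)) /= subr_eq0 => /eqP Ebuv.
  have /eqP := bD u v; rewrite -Ebuv -mulr2n mulrn_eq0 /= => /eqP.
  by [].
apply/matrixP => i j; rewrite mxE -(b0 (delta_mx i 0) (delta_mx j 0)) /b.
by rewrite trmxC_delta -rowE -colE !mxE.
Qed.

End quadratic_form.

(** Nonnegative values are real, so [A] and [A^t*] have the same quadratic form; by [qform_eq0] they
    are equal. *)
Lemma psdP (R : realType) n (A : 'M[R[i]]_n) : psd A <-> forall v, 0 <= qform A v.
Proof.
split=> [[_ h] //|h]; split=> //; apply/eqP; rewrite -subr_eq0; apply/eqP.
apply: qform_eq0 => v; rewrite qformD -scaleN1r qformZ mulN1r qform_conj.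
by apply/eqP; rewrite subr_eq0 -CrealE ger0_real.
Qed.

(** * Rational matrices and the function s(G(s) - G(oo)) *)

Section transfer_matrices.
Context {R : realType} {n : nat}.
Implicit Types (G F : 'M[{fraction {poly R}}]_n) (s z : R[i]) (f : {fraction {poly R}}).
Local Notation toC := (map_poly (real_complex R)).

Definition regular G s := forall i j, (toC (denom (G i j))).[s] != 0.

Lemma pole_order_leP G z m :
  (pole_order G z <= m)%N <-> forall i j, (mup z (toC (denom (G i j))) <= m)%N.
Proof.
split=> [/bigmax_leqP h i j|h].
  by have /bigmax_leqP/(_ j isT) := h i isT.
by apply/bigmax_leqP => i _; apply/bigmax_leqP => j _.
Qed.

Lemma regularP G z : ~ is_pole G z <-> regular G z.
Proof.
have E i j : (mup z (toC (denom (G i j))) <= 0)%N = ((toC (denom (G i j))).[z] != 0).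
  by rewrite leqNgt -XsubC_dvd ?denomC_neq0// dvdp_XsubCl.
split=> [/negP|h].
  by rewrite -leqNgt => /pole_order_leP h i j; rewrite -E.
by apply/negP; rewrite -leqNgt; apply/pole_order_leP => i j; rewrite E.
Qed.

Lemma near_regular G z : \forall s \near z^', regular G s.
Proof.
by apply: filter_forall => i; apply: filter_forall => j; exact: near_dnbhs_denom.
Qed.

Lemma mup_feval f z m (l : R[i]) :
  (s - z) ^+ m * feval f s @[s --> z^'] --> l -> (mup z (toC (denom f)) <= m)%N.
Proof. exact: (cvg_mup_le (coprime_numerC_denomC f) (denomC_neq0 f)). Qed.

(** A finite limit is the case of exponent 0 in [mup_feval]. It serves to transfer regularity
    between [G] and s(G - G(oo)), which are related only near a point. *)
Lemma feval_regular f z (l : R[i]) :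
  feval f s @[s --> z^'] --> l -> (toC (denom f)).[z] != 0.
Proof.
move=> h; have : (mup z (toC (denom f)) <= 0)%N.
  apply: (@mup_feval f z 0 l); apply: cvg_near_eq h.
  by apply: nearW => s; rewrite expr0 mul1r.
by rewrite leqNgt -XsubC_dvd ?denomC_neq0// dvdp_XsubCl.
Qed.

Lemma cinfty_neq0 : \forall s \near cinfty R, s != 0.
Proof. by exists 0 => s; rewrite normr_gt0. Qed.

Lemma cinfty_invr : s^-1 @[s --> cinfty R] --> (0 : R[i]).
Proof.
apply/cvgr0Pnorm_lt => e e0.
have eR : e = (complex.Re e)%:C by rewrite RRe_real// gtr0_real.
have eV : ((complex.Re e)^-1)%:C = e^-1 by rewrite [in RHS]eR fmorphV.
exists (complex.Re e)^-1 => s; rewrite eV => h.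
have s0 : 0 < `|s| by rewrite (lt_trans _ h)// invr_gt0.
by rewrite normfV -[e]invrK ltf_pV2 ?posrE// invr_gt0.
Qed.

Section infinity.
Context {T : Type} {H : set_system T} {FH : ProperFilter H}.
Variable u : T -> R[i].
Hypotheses (u0 : \forall x \near H, u x != 0) (uV : (u x)^-1 @[x --> H] --> (0 : R[i])).

Lemma near_regular_infty G : \forall x \near H, regular G (u x).
Proof.
apply: filter_forall => i; apply: filter_forall => j.
exact: near_horner_neq0 (denomC_neq0 _).
Qed.

Lemma cvg_feval_infty f : (size (numer f) <= size (denom f))%N ->
  feval f (u x) @[x --> H] --> ((numer f)`_(size (denom f)).-1 / lead_coef (denom f))%:C.
Proof.
move=> nd.
rewrite rmorphM fmorphV /= -lead_coef_map.
rewrite -(coef_map (real_complex R)) -(size_map_poly (real_complex R) (denom f)).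
by apply: cvg_horner_ratio; rewrite ?denomC_neq0 ?size_map_poly.
Qed.

End infinity.

(** The quotients of coefficients form a real matrix that is a limit of [G] at infinity. So [get]
    returns a limit, and limits are unique. *)
Lemma at_inftyE G i j : is_proper G ->
  at_infty G i j = (numer (G i j))`_(size (denom (G i j))).-1 / lead_coef (denom (G i j)).
Proof.
move=> hG.
have hc k l : feval (G k l) s @[s --> cinfty R] -->
  ((numer (G k l))`_(size (denom (G k l))).-1 / lead_coef (denom (G k l)))%:C.
  exact: (@cvg_feval_infty _ _ (cinfty_filter R) (fun s => s) cinfty_neq0 cinfty_invr _ (hG k l)).
have : mxeval G s @[s --> cinfty R] --> map_mx (real_complex R) (at_infty G).
  rewrite /at_infty; apply: (@getPex _ [set D : 'M[R]_n |
        mxeval G s @[s --> cinfty R] --> map_mx (real_complex R) D]).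
  exists (\matrix_(k, l) ((numer (G k l))`_(size (denom (G k l))).-1 / lead_coef (denom (G k l)))).
  apply: cvg_mx_entry => k l; rewrite !mxE.
  apply: (cvg_near_eq (f := feval (G k l))); first by apply: nearW => s; rewrite mxE.
  exact: hc.
move=> h0; have := @cvg_entry_mx _ _ _ _ _ _ _ _ i j h0; rewrite mxE => h.
apply: complexI; apply: (cvg_unique _ _ (hc i j)) => //.
apply: (cvg_near_eq (f := fun s => mxeval G s i j)); last exact: h.
by apply: nearW => s; rewrite mxE.
Qed.

Lemma sG_sub_inftyE G i j : let c := (at_infty G i j)%:P in
  sG_sub_infty G i j =
  tofrac ('X * (numer (G i j) - c * denom (G i j))) / tofrac (denom (G i j)).
Proof.
move=> c; rewrite !mxE [in LHS](fraction_numer_denom (G i j)) tofracM tofracB tofracM.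
by rewrite -mulrA mulrBl mulfK// tofrac_eq0 denom_neq0.
Qed.

Lemma feval_sG G i j s : regular G s ->
  feval (sG_sub_infty G i j) s = s * (feval (G i j) s - (at_infty G i j)%:C).
Proof.
move=> /(_ i j) ds; rewrite (feval_frac (sG_sub_inftyE G i j))//.
rewrite rmorphM rmorphB rmorphM /= map_polyX map_polyC /= !hornerE /=.
by rewrite /feval -mulrA mulrBl mulfK.
Qed.

(** Subtracting G(oo) cancels the coefficient of index deg D, where D is the denominator;
    multiplying by X then raises the degree to at most deg D. Thus s(G - G(oo)) is again proper. *)
Lemma size_numer_sG G i j : is_proper G ->
  (size ('X * (numer (G i j) - (at_infty G i j)%:P * denom (G i j)))%R <= size (denom (G i j)))%N.
Proof.
move=> hG; have := hG i j; rewrite at_inftyE//.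
set N := numer _; set D := denom _; set c := _ / _ => ND.
have D0 : D != 0 by exact: denom_neq0.
have D1 : (0 < size D)%N by rewrite size_poly_gt0.
have h : (size (N - c%:P * D)%R <= (size D).-1)%N.
  apply/leq_sizeP => k; rewrite coefB coefCM leq_eqVlt => /predU1P[<-|].
    by rewrite -/(lead_coef D) divfK ?subrr// lead_coef_eq0.
  rewrite prednK// => Dk.
  by rewrite !nth_default ?mulr0 ?subrr// (leq_trans ND).
by rewrite (leq_trans (size_polyMleq _ _))// size_polyX addSn add1n /= -(prednK D1) ltnS.
Qed.

Lemma near_feval_sG G i j z : \forall s \near z^',
  feval (sG_sub_infty G i j) s = s * (feval (G i j) s - (at_infty G i j)%:C).
Proof. by apply: filterS (near_regular G z) => s; exact: feval_sG. Qed.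

Lemma near_dnbhs_neq0 z : \forall s \near z^', s != 0.
Proof.
have := near_dnbhs_nonroot z (negbT (polyX_eq0 R[i])).
by apply: filterS => s; rewrite hornerX.
Qed.

Lemma near_feval_G G i j z : \forall s \near z^',
  feval (G i j) s = feval (sG_sub_infty G i j) s / s + (at_infty G i j)%:C.
Proof.
apply: filterS2 (near_dnbhs_neq0 z) (near_feval_sG G i j z) => s s0 ->.
by rewrite mulrAC divff// mul1r subrK.
Qed.

(** Near [z] one has G = F/s + G(oo), where F = s(G - G(oo)), and the right-hand side has a finite
    limit because z is nonzero. *)
Lemma sG_regular G z : z != 0 -> regular (sG_sub_infty G) z -> regular G z.
Proof.
move=> z0 Fz i j.
apply: (@feval_regular _ _ (feval (sG_sub_infty G i j) z / z + (at_infty G i j)%:C)).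
apply: (cvg_near_eq (f := fun s => feval (sG_sub_infty G i j) s / s + (at_infty G i j)%:C)).
  by apply: filterS (near_feval_G G i j z) => s ->.
apply: cvgD; last exact: cvg_cst.
apply: cvgM; last by apply: cvgV; [exact: z0|exact: dnbhs_cvg].
by apply: cvg_feval; [exact: Fz|exact: dnbhs_cvg].
Qed.

End transfer_matrices.

(** * From lossless negative imaginary to lossless positive real *)

Section proper_on.
Context {K : fieldType}.
Implicit Types (N : K -> Prop) (f g : K -> K).

(** The function v^*Fv has complex coefficients, so it is not an element of [{fraction {poly R}}];
    it is given by a quotient of polynomials whose denominator has no zero in [N]. *)
Definition proper_on N f := exists p q : {poly K},
  [/\ q != 0, (size p <= size q)%N & forall s, N s -> q.[s] != 0 /\ f s = p.[s] / q.[s]].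

Lemma proper_onD N f g : proper_on N f -> proper_on N g ->
  proper_on N (fun s => f s + g s).
Proof.
move=> [p [q [q0 pq fE]]] [p' [q' [q'0 pq' gE]]].
exists (p * q' + p' * q), (q * q'); split; first by rewrite mulf_neq0.
  rewrite [leqRHS]size_mul// (leq_trans (size_polyD _ _))// geq_max.
  apply/andP; split; apply: leq_trans (size_polyMleq _ _) _.
    by rewrite -!subn1 leq_sub2r// leq_add2r.
  by rewrite -!subn1 leq_sub2r// [leqRHS]addnC leq_add2r.
move=> s Ns; have [qs ->] := fE s Ns; have [q's ->] := gE s Ns.
by rewrite hornerM mulf_neq0// addf_div// hornerD !hornerM.
Qed.

Lemma proper_onZ N (c : K) f : proper_on N f -> proper_on N (fun s => c * f s).
Proof.
move=> [p [q [q0 pq fE]]]; exists (c *: p), q; split=> //.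
  exact: leq_trans (size_scale_leq _ _) pq.
by move=> s Ns; have [qs ->] := fE s Ns; rewrite hornerZ mulrA.
Qed.

Lemma proper_on_sum N (I : Type) (r : seq I) (h : I -> K -> K) :
  (forall i, proper_on N (h i)) -> proper_on N (fun s => \sum_(i <- r) h i s).
Proof.
move=> hh; elim: r => [|i r IH].
  exists 0, 1; split; rewrite ?oner_eq0 ?size_poly0// => s _.
  by rewrite hornerC oner_eq0 big_nil horner0 mul0r.
have [p [q [q0 pq hE]]] := proper_onD (hh i) IH.
by exists p, q; split=> // s Ns; rewrite big_cons; exact: hE.
Qed.

End proper_on.

Lemma cvg_limit_eq (K : numFieldType) (T : Type) (H : set_system T) {FH : ProperFilter H}
    (f : T -> K) (a b : K) :
  f x @[x --> H] --> a -> f x @[x --> H] --> b -> a = b.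
Proof. by move=> fa fb; apply: (cvg_unique _ fa fb). Qed.

(** * Symmetry of G(oo) and absence of poles in the left half-plane *)

Section forward.
Context {R : realType} {n : nat}.
Implicit Types (G F : 'M[{fraction {poly R}}]_n) (s z : R[i]).
Local Notation toC := (map_poly (real_complex R)).

Lemma proper_on_qform_sG G (v : 'cV[R[i]]_n) : is_proper G ->
  proper_on (regular G) (fun s => qform (mxeval (sG_sub_infty G) s) v).
Proof.
move=> hG.
have hE i j : proper_on (regular G) (feval (sG_sub_infty G i j)).
  exists (toC ('X * (numer (G i j) - (at_infty G i j)%:P * denom (G i j)))), (toC (denom (G i j))).
  split; [exact: denomC_neq0|by rewrite !size_map_poly size_numer_sG|].
  by move=> s Gs; split; [exact: Gs|rewrite (feval_frac (sG_sub_inftyE G i j))].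
have : proper_on (regular G) (fun s => \sum_j \sum_i
    ((v i 0)^*%R * v j 0) * feval (sG_sub_infty G i j) s).
  apply: proper_on_sum => j; apply: proper_on_sum => i; exact: proper_onZ.
move=> [p [q [q0 pq h]]]; exists p, q; split=> // s Gs.
have [qs E] := h s Gs; split=> //; rewrite -E qformE.
by apply: eq_bigr => j _; apply: eq_bigr => i _; rewrite mxE mulrAC.
Qed.

Lemma cvg_qform (T : Type) (H : set_system T) {FH : Filter H}
    (f : T -> 'M[R[i]]_n) (A : 'M[R[i]]_n) v :
  (forall i j, f x i j @[x --> H] --> A i j) ->
  qform (f x) v @[x --> H] --> qform A v.
Proof.
move=> h; rewrite qformE; under eq_fun do rewrite qformE.
apply: cvg_sumr => j _; apply: cvg_sumr => i _.
by apply: cvgM; [apply: cvgM; [exact: cvg_cst|exact: h]|exact: cvg_cst].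
Qed.

Lemma imagE (y : R) : (y *i : R[i]) = 'i%R * y%:C.
Proof. by rewrite -complexiE; simpc. Qed.

Lemma near_imag_neq0 : \forall w \near (+oo : set_system R), (w *i : R[i]) != 0.
Proof.
have := nbhs_pinfty_gt (num_real (0 : R)); apply: filterS => w w0.
by rewrite eq_complex /= eqxx /= gt_eqF.
Qed.

Lemma cvg_imag_inv : (w *i)^-1 @[w --> (+oo : set_system R)] --> (0 : R[i]).
Proof.
apply: (cvg_comp (fun w : R => w *i) (fun s : R[i] => s^-1) _ cinfty_invr).
move=> P [M hM].
have := nbhs_pinfty_gt (num_real `|M|); apply: filterS => w Mw; apply: hM.
rewrite imagE normrM normCi mul1r normc_def /= expr0n addr0 sqrtr_sqr ltcR.
by rewrite (le_lt_trans (ler_norm M))// (lt_le_trans Mw)// ler_norm.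
Qed.

Lemma conj_imag (w : R) : ((w *i : R[i])^*)%R = - (w *i).
Proof. by rewrite imagE rmorphM /= conjCi conj_Creal ?mulNr//; apply/complex_realP; exists w. Qed.

Lemma hermitian_entry G s :
  'i%C *: (mxeval G s - (mxeval G s)^t*) = 0 ->
  forall i j, feval (G i j) s = feval (G j i) (s^*)%R.
Proof.
move=> /eqP; rewrite scalemx_eq0 complexiE (negPf (neq0Ci _)) /= subr_eq0 => /eqP E i j.
by have /matrixP/(_ i j) := E; rewrite !mxE => ->; rewrite feval_conj.
Qed.

Section lossless.
Variable G : 'M[{fraction {poly R}}]_n.
Hypotheses (hG : is_proper G) (hL : lossless_negative_imaginary G).

(** The coefficients being real, the conjugate of the value at [w *i] is the value at [- (w *i)].
    This removes conjugation and leaves a rational identity in s. *)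
Lemma lossless_symmetric (w : R) : 0 < w -> regular G (w *i) ->
  forall i j, feval (G i j) (w *i) = feval (G j i) (- (w *i)).
Proof.
move=> w0 /regularP Gw i j; rewrite -conj_imag; apply: hermitian_entry.
by case: hL => _; apply.
Qed.

Lemma near_imag_regular :
  \forall w \near (+oo : set_system R), 0 < w /\ regular G (w *i).
Proof.
apply: filterS2 (nbhs_pinfty_gt (num_real (0 : R)))
  (near_regular_infty near_imag_neq0 cvg_imag_inv G) => w.
by [].
Qed.

(** Both sides of [lossless_symmetric] have limits as w tends to infinity, the entries (i, j) and
    (j, i) of G(oo). *)
Lemma lossless_at_infty_sym : at_infty G = (at_infty G)^T.
Proof.
apply/matrixP => i j; rewrite mxE; apply: complexI.
have uN0 : \forall w \near (+oo : set_system R), - (w *i : R[i]) != 0.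
  by apply: filterS near_imag_neq0 => w; rewrite oppr_eq0.
have uNV : (- (w *i))^-1 @[w --> (+oo : set_system R)] --> (0 : R[i]).
  rewrite -[X in _ --> X]oppr0.
  apply: (cvg_near_eq (f := fun w : R => - (w *i : R[i])^-1)).
    by apply: nearW => w; rewrite invrN.
  by apply: cvgN; exact: cvg_imag_inv.
have h1 := cvg_feval_infty near_imag_neq0 cvg_imag_inv (hG i j).
have h2 := cvg_feval_infty uN0 uNV (hG j i).
rewrite -!at_inftyE// in h1 h2.
apply: (cvg_limit_eq (h1 _)).
apply: (cvg_near_eq (f := fun w : R => feval (G j i) (- w *i))); last exact: h2 _.
apply: filterS near_imag_regular => w [w0 Gw].
by rewrite lossless_symmetric.
Qed.

(** Clearing denominators in G(s) = G(-s)^T gives a polynomial [P] vanishing at [w *i] for all large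
    w, so P = 0. At a pole z of the entry (i, j), this makes either its numerator vanish at z,
    against coprimality, or the denominator of the entry (j, i) vanish at -z, against condition
    (i). *)
Lemma lossless_no_left_pole z : 'Re z < 0 -> regular G z.
Proof.
move=> z0 i j; apply/negP => /eqP dz.
pose N k l := toC (numer (G k l)); pose D k l := toC (denom (G k l)).
pose P := N i j * (D j i \Po (- 'X)) - (N j i \Po (- 'X)) * D i j.
have P0 : P = 0.
  apply/eqP; apply: contraT => P0.
  have Pw := near_horner_neq0 near_imag_neq0 cvg_imag_inv P0.
  have [w [[w0 Gw] /negP]] := filter_ex (filterI near_imag_regular (Pw _)); case.
  rewrite /P hornerD hornerN !hornerM !horner_comp !hornerN !hornerX.
  have := lossless_symmetric w0 Gw i j; rewrite /feval -/(N i j) -/(N j i) -/(D i j) -/(D j i).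
  have D1 : (D i j).[w *i] != 0 by exact: Gw.
  have D2 : (D j i).[- (w *i)] != 0.
    by rewrite -conj_imag /D [X in X != 0]horner_conj conjc_eq0; exact: Gw.
  by move=> /eqP; rewrite eqr_div// => /eqP ->; rewrite subrr.
have : P.[z] = 0 by rewrite P0 horner0.
rewrite /P hornerD hornerN !hornerM !horner_comp !hornerN !hornerX [(D i j).[z]]dz mulr0 subr0.
move=> /eqP; rewrite mulf_eq0 => /orP[nz|].
  have := coprimep_root (coprime_numerC_denomC (G i j)) nz.
  by rewrite dz eqxx.
apply/negP; have [[+ _ _ _ _] _] := hL.
move=> /(_ (- z)); rewrite -ltcR complexRe raddfN /= oppr_gt0 => /(_ z0) /regularP.
exact.
Qed.

End lossless.
End forward.

Section polynomial_derivative.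
Context {K : numFieldType}.

Lemma derivable_poly (p : {poly K}) (x : K) : derivable (horner p) x 1.
Proof.
elim/poly_ind: p => [|p c IH].
  rewrite (_ : horner 0 = cst 0); first exact: derivable_cst.
  by apply/funext => y; rewrite horner0.
rewrite (_ : horner _ = (horner p * id + cst c)%R).
  by apply: derivableD; [apply: derivableM => //; exact: derivable_id|exact: derivable_cst].
by apply/funext => y; rewrite hornerMXaddC.
Qed.

Lemma derivable_horner_div (p q : {poly K}) (x : K) : q.[x] != 0 ->
  derivable (fun y => p.[y] / q.[y]) x 1.
Proof.
move=> qx; apply: (@derivableM _ _ (horner p) (fun y => (q.[y])^-1)).
  exact: derivable_poly.
by apply: derivableV => //; exact: derivable_poly.
Qed.

End polynomial_derivative.

(** With a = s, b = s - z and i the imaginary unit, this converts the product in condition (iv) into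
    (s - z) s (g - c). *)
Lemma scale_residue (K : fieldType) (a b i g c : K) : i != 0 ->
  a / i * (b * (i * g)) - b * (a * c) = b * (a * (g - c)).
Proof. by move=> i0; field. Qed.

(** * Residues of s(G - G(oo)) at the poles of G *)

Section residues.
Context {R : realType} {n : nat}.
Implicit Types (F : 'M[{fraction {poly R}}]_n) (s z : R[i]).
Variable G : 'M[{fraction {poly R}}]_n.
Local Notation F := (sG_sub_infty G).

Lemma cvg_sG i j z (l : R[i]) : feval (G i j) s @[s --> z^'] --> l ->
  feval (F i j) s @[s --> z^'] --> z * (l - (at_infty G i j)%:C).
Proof.
move=> h; apply: (cvg_near_eq (f := fun s => s * (feval (G i j) s - (at_infty G i j)%:C))).
  by apply: filterS (near_feval_sG G i j z) => s ->.
apply: cvgM; first exact: dnbhs_cvg.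
exact: (cvgB h (cvg_cst _)).
Qed.

Lemma cvg_sG_regular i j z : regular G z ->
  feval (F i j) s @[s --> z^'] --> z * (feval (G i j) z - (at_infty G i j)%:C).
Proof.
move=> Gz; apply: (@cvg_sG _ _ _ (feval (G i j) z)).
by apply: cvg_feval; [exact: Gz|exact: dnbhs_cvg].
Qed.

Lemma regular_sG z : regular G z -> regular F z.
Proof. move=> Gz i j; exact: feval_regular (cvg_sG_regular Gz). Qed.

Lemma psd0 : psd (0 : 'M[R[i]]_n).
Proof. by apply/psdP => v; rewrite /qform mulmx0 mul0mx mxE. Qed.

Lemma psdZ (c : R) (A : 'M[R[i]]_n) : 0 <= c -> psd A -> psd (c%:C *: A).
Proof.
move=> c0 /psdP hA; apply/psdP => v; rewrite qformZ mulr_ge0//.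
by rewrite ler0c.
Qed.

Lemma psd_tr (A : 'M[R[i]]_n) : psd A -> psd A^T.
Proof.
by move=> /psdP hA; apply/psdP => v; rewrite qform_tr.
Qed.

Hypotheses (hG : is_proper G) (hL : lossless_negative_imaginary G).

(** If K is the limit of (s - i y) i G, the residue of s(G - G(oo)) is (i y / i) K = y K with y > 0;
    the term with G(oo) vanishes in the limit. *)
Lemma residue_imag (y : R) : 0 < y -> ~ regular G (y *i) ->
  exists2 A, psd A & forall i j, (s - y *i) * feval (F i j) s @[s --> (y *i : R[i])^'] --> A i j.
Proof.
move=> y0 ny; have [[_ _ _ h _] _] := hL.
have py : is_pole G (y *i) by apply: contrapT => /regularP.
have [_ [K hK psdK]] := h _ y0 py.
exists (y%:C *: K); first by apply: psdZ => //; exact: ltW.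
move=> i j; have hK' := @cvg_entry_mx _ _ _ _ _ _ _ _ i j hK.
have Ey : (y *i : R[i]) / 'i%C = y%:C by rewrite imagE complexiE mulrAC divff ?mul1r// neq0Ci.
have i0 : 'i%C != 0 :> R[i] by rewrite complexiE neq0Ci.
have -> : (y%:C *: K) i j = (y *i : R[i]) / 'i%C * K i j
    - (y *i - y *i) * (y *i * (at_infty G i j)%:C).
  by rewrite subrr mul0r subr0 Ey mxE.
apply: (cvg_near_eq (f := fun s => s / 'i%C * (((s - y *i) *: ('i%C *: mxeval G s)) i j)
    - (s - y *i) * (s * (at_infty G i j)%:C))).
  apply: filterS (near_feval_sG G i j (y *i)) => s ->.
  rewrite !mxE; exact: scale_residue.
have cs : s @[s --> (y *i : R[i])^'] --> (y *i : R[i]) by exact: dnbhs_cvg.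
exact: (cvgB (cvgM (cvgM cs (cvg_cst _)) (hK' _))
             (cvgM (cvgB cs (cvg_cst _)) (cvgM cs (cvg_cst _)))).
Qed.

(** Since s F = s^2 G - s^2 G(oo), the residue of F at 0 is the limit of s^2 G in condition
    (iii). *)
Lemma residue_zero : ~ regular G 0 ->
  exists2 A, psd A & forall i j, (s - 0) * feval (F i j) s @[s --> (0 : R[i])^'] --> A i j.
Proof.
move=> n0; have [[_ _ h _ _] _] := hL.
have p0 : is_pole G 0 by apply: contrapT => /regularP.
have [_ [K hK psdK] _] := h p0; exists K => // i j.
have hK' := @cvg_entry_mx _ _ _ _ _ _ _ _ i j hK.
rewrite -[X in _ --> X]subr0 -[X in _ - X](mul0r (at_infty G i j)%:C).
rewrite -[X in _ - X * _](expr0n R[i] 2).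
apply: (cvg_near_eq (f := fun s => (s ^+ 2 *: mxeval G s) i j - s ^+ 2 * (at_infty G i j)%:C)).
  apply: filterS (near_feval_sG G i j 0) => s ->.
  by rewrite !mxE subr0 [RHS]mulrA -expr2 mulrBr.
have cs : s @[s --> (0 : R[i])^'] --> (0 : R[i]) by exact: dnbhs_cvg.
exact: (cvgB (hK' _) (cvgM (cvg_exprn (k := 2) cs) (cvg_cst _))).
Qed.

End residues.

(** * Positive realness of s(G - G(oo)) *)

Section forward_positive.
Context {R : realType} {n : nat}.
Variable G : 'M[{fraction {poly R}}]_n.
Hypotheses (hG : is_proper G) (hL : lossless_negative_imaginary G).
Implicit Types (s z : R[i]).
Local Notation F := (sG_sub_infty G).
Local Notation toC := (map_poly (real_complex R)).

Lemma cvg_conj_dnbhs (K : numClosedFieldType) (z : K) : (s^*)%R @[s --> z^'] --> ((z^*)%R)^'.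
Proof.
have cs : s @[s --> z^'] --> z by exact: dnbhs_cvg.
move=> P /(cvg_conjC cs); rewrite /nbhs /=.
apply: filterS2 (near_dnbhs_neq z) => s sz; apply.
by rewrite (inj_eq (can_inj conjCK)).
Qed.

(** Puts every point in the form required by [Re_ge0_simple_poles], with A = 0 where [G] is regular.
    Condition (i) and [lossless_no_left_pole] confine the poles to the axis. *)
Lemma residue_sG z : exists A : 'M[R[i]]_n, [/\ psd A,
    forall i j, (s - z) * feval (F i j) s @[s --> z^'] --> A i j
  & A != 0 -> 'Re z = 0].
Proof.
have [Gz|nGz] := pselect (regular G z).
  exists 0; split; [exact: psd0| |by rewrite eqxx].
  move=> i j.
  have -> : (0 : 'M[R[i]]_n) i j = (z - z) * (z * (feval (G i j) z - (at_infty G i j)%:C)).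
    by rewrite subrr mul0r mxE.
  have cs : s @[s --> z^'] --> z by exact: dnbhs_cvg.
  exact: (cvgM (cvgB cs (cvg_cst _)) (cvg_sG_regular Gz)).
have Rez : 'Re z = 0.
  apply/eqP; apply: contra_notT nGz; rewrite real_neqr_lt ?Creal_Re//.
  case/orP => [|z0]; first exact: lossless_no_left_pole.
  have [[h _ _ _ _] _] := hL; apply/regularP; apply: h.
  by rewrite -Re_gt0E.
have Ez : z = (complex.Im z) *i.
  apply/eqP; rewrite eq_complex /= eqxx andbT.
  by have := Rez; rewrite -complexRe => /complexI ->.
suff [A pA hA] : exists2 A, psd A &
    forall i j, (s - z) * feval (F i j) s @[s --> z^'] --> A i j.
  by exists A; split.
have [y0|y0|y0] := ltgtP 0 (complex.Im z).
- by rewrite Ez in nGz *; exact: residue_imag.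
(* Condition (iv) covers only the upper half of the axis. The residue at z is the entrywise
   conjugate of the residue A at its conjugate, that is the transpose of A, as A is Hermitian. *)
- have Ez' : (- complex.Im z) *i = (z^*)%R by rewrite [in RHS]Ez conj_imag; simpc.
  have nG' : ~ regular G ((- complex.Im z) *i).
    move=> h; apply: nGz => i j; have := h i j.
    by rewrite Ez' [X in X != 0]horner_conj conjc_eq0.
  have y1 : 0 < - complex.Im z by rewrite oppr_gt0.
  have [A pA hA] := residue_imag hL y1 nG'.
  exists A^T; first exact: psd_tr.
  move=> i j; have [AE _] := pA.
  have -> : A^T i j = ((A i j)^*)%R by rewrite -{1}AE !mxE.
  have hA' := hA i j; rewrite Ez' in hA'.
  have hc := cvg_conjC (cvg_comp _ _ (@cvg_conj_dnbhs _ z) hA').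
  apply: (cvg_near_eq (f := fun s => (((s^*)%R - (z^*)%R) * feval (F i j) (s^*)%R)^*%R)).
    by apply: nearW => s; rewrite rmorphM rmorphB /= feval_conj !conjCK.
  exact: hc.
- have z0 : z = 0 by rewrite Ez -y0.
  by rewrite z0 in nGz *; exact: residue_zero.
Qed.

(** On the axis G is Hermitian and G(oo) is real symmetric, while conjugation changes the sign of s;
    so s(G - G(oo)) is skew-Hermitian. *)
Lemma sG_skew (w : R) : 0 < w -> regular G (w *i) ->
  mxeval F (w *i) + (mxeval F (w *i))^t* = 0.
Proof.
move=> w0 Gw.
have E k l : mxeval F (w *i) k l = w *i * (feval (G k l) (w *i) - (at_infty G k l)%:C).
  by rewrite -feval_sG// [LHS]mxE.
move: (mxeval F (w *i)) E => M E; apply/matrixP => i j; rewrite !mxE !E.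
rewrite rmorphM rmorphB /= -feval_conj conj_imag.
rewrite (lossless_symmetric hL w0 Gw i j) conj_Creal; last first.
  by apply/complex_realP; exists (at_infty G j i).
have := lossless_at_infty_sym hG hL; move/matrixP => /(_ i j); rewrite mxE => ->.
by rewrite mulNr subrr.
Qed.

Lemma Re_qform_skew (A : 'M[R[i]]_n) v : qform (A^t* + A) v = 2 * 'Re (qform A v).
Proof.
by rewrite qformD qform_conj addrC ReE mulrCA divff ?mulr1// pnatr_eq0.
Qed.

Lemma sG_lossless_positive_real : lossless_positive_real F.
Proof.
have regR s : 0 < complex.Re s -> regular G s.
  by have [[h _ _ _ _] _] := hL; move=> s0; apply/regularP; exact: h.
split; last first.
  move=> w w0 /regularP Fw; apply: sG_skew => //; apply: sG_regular => //.
  by rewrite eq_complex /= eqxx gt_eqF.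
split.
- move=> i j s s0; rewrite (_ : (fun z => _) = feval (F i j)); last first.
    by apply/funext => z; rewrite mxE.
  apply: derivable_horner_div; exact: (regular_sG (regR _ s0)).
- move=> x x0 i j; rewrite mxE CrealE -feval_conj conj_Creal//.
  by apply/complex_realP; exists x.
- move=> s s0; apply/psdP => v; rewrite Re_qform_skew mulr_ge0//.
  have [p [q [q0 pq hpq]]] := proper_on_qform_sG v hG.
  (* Any frequency at which [G] is regular supplies the point of the axis where the real part of
     v^*Fv is known to be 0. *)
  have [w [w0 Gw]] := filter_ex (near_imag_regular G).
  have [qw gw] := hpq _ Gw; have [qs gs] := hpq _ (regR _ s0).
  rewrite gs; apply: (@Re_ge0_simple_poles _ p q (w *i)) => //.
  + move=> z; have [A [pA hA Az]] := residue_sG z; exists (qform A v).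
      have h := @cvg_qform _ _ _ _ _ (fun s => (s - z) *: mxeval F s) A v.
      apply: (cvg_near_eq (f := fun s => qform ((s - z) *: mxeval F s) v)).
        apply: filterS (near_regular G z) => x /hpq[qx gx].
        by rewrite qformZ gx.
      apply: h => i j; apply: (cvg_near_eq (f := fun s => (s - z) * feval (F i j) s)).
        by apply: nearW => x; rewrite !mxE.
      exact: hA.
    split; first by move/psdP : pA.
    move=> r0; apply: Az; apply: contra_neq r0 => ->.
    by rewrite /qform mulmx0 mul0mx mxE.
  + by rewrite -complexRe.
  + rewrite -gw; have := Re_qform_skew (mxeval F (w *i)) v.
    rewrite addrC sG_skew// /qform mulmx0 mul0mx mxE => /esym/eqP.
    by rewrite mulf_eq0 pnatr_eq0 /= => /eqP.
  + by rewrite Re_gt0E.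
Qed.

End forward_positive.

(** * From lossless positive real to lossless negative imaginary *)

Lemma derivable_cvg_dnbhs (K : numFieldType) (f : K -> K) (z : K) :
  derivable f z 1 -> f s @[s --> z^'] --> f z.
Proof.
by move=> /derivable1_diffP/differentiable_continuous/continuous_withinNx.
Qed.

(** * Poles on the imaginary axis of a function with positive semidefinite Hermitian part *)

Section positive_real_poles.
Context {R : realType} {n : nat}.
Variables (F : 'M[{fraction {poly R}}]_n) (z : R[i]).
Implicit Types (s : R[i]) (A : 'M[R[i]]_n).
Hypotheses (rez : 'Re z = 0)
  (hpos : forall s, 0 < complex.Re s -> psd ((mxeval F s)^t* + mxeval F s)).

Lemma pole_order_cvg m : (pole_order F z <= m)%N ->
  exists A, forall i j, (s - z) ^+ m * feval (F i j) s @[s --> z^'] --> A i j.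
Proof.
move=> /pole_order_leP h.
have hc (k : 'I_n * 'I_n) : exists l : R[i],
    (s - z) ^+ m * feval (F k.1 k.2) s @[s --> z^'] --> l.
  exact: (mup_cvg _ (denomC_neq0 _) (h k.1 k.2)).
have [l hl] := choice hc.
exists (\matrix_(i, j) l (i, j)) => i j; rewrite mxE; exact: (hl (i, j)).
Qed.

Lemma residue_rays m A (v : 'cV[R[i]]_n) (u : R[i]) :
  (forall i j, (s - z) ^+ m * feval (F i j) s @[s --> z^'] --> A i j) ->
  0 < 'Re u -> 0 <= 'Re (qform A v / u ^+ m).
Proof.
move=> hA; apply: (@Re_ge0_rays _ (fun s => qform (mxeval F s) v) z).
  have h := @cvg_qform _ _ _ _ _ (fun s => (s - z) ^+ m *: mxeval F s) A v.
  apply: (cvg_near_eq (f := fun s => qform ((s - z) ^+ m *: mxeval F s) v)).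
    by apply: nearW => s; rewrite qformZ.
  apply: h => i j; apply: (cvg_near_eq (f := fun s => (s - z) ^+ m * feval (F i j) s)).
    by apply: nearW => x; rewrite !mxE.
  exact: hA.
move=> s; rewrite rez Re_gt0E => /hpos/psdP/(_ v).
by rewrite Re_qform_skew pmulr_rge0.
Qed.

(** Descent on a bound for the order. For a bound k + 2 the limit of (s - z)^(k+2) F is 0 by
    [eq0_half_plane_pow], and [cvg_mup_neq0] then excludes an entry of order k + 2. *)
Lemma pole_order_le1 : (pole_order F z <= 1)%N.
Proof.
suff h k : (pole_order F z <= k.+1)%N -> (pole_order F z <= 1)%N.
  exact: (h _ (leqnSn _)).
elim: k => // k IH hk; apply: IH.
have [A hA] := pole_order_cvg hk.
have A0 : A = 0.
  apply: qform_eq0 => v; apply: (@eq0_half_plane_pow _ _ k.+2) => // u u0.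
  exact: residue_rays.
apply/pole_order_leP => i j; rewrite leqNgt; apply/negP => kmu.
have h := @cvg_mup_neq0 _ _ _ _ k.+2 _ (coprime_numerC_denomC (F i j)) (denomC_neq0 _).
have := h _ _ kmu (hA i j).
by rewrite A0 mxE eqxx.
Qed.

Lemma simple_pole_psd : exists2 A, psd A &
  forall i j, (s - z) * feval (F i j) s @[s --> z^'] --> A i j.
Proof.
have [A hA] := pole_order_cvg pole_order_le1; exists A; last exact: hA.
apply/psdP => v; apply: ge0_half_plane => u u0.
by rewrite -[u]expr1; exact: residue_rays hA u0.
Qed.

End positive_real_poles.

(** * Recovering the conditions on G from those on s(G - G(oo)) *)

Section backward.
Context {R : realType} {n : nat}.
Variable G : 'M[{fraction {poly R}}]_n.
Local Notation F := (sG_sub_infty G).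
Hypotheses (hG : is_proper G) (sym : at_infty G = (at_infty G)^T)
  (hF : lossless_positive_real F).
Implicit Types (s z : R[i]).

(** A differentiable entry has a finite limit at [s], which excludes a pole whatever value [feval]
    takes there by convention. *)
Lemma positive_real_regular s : 0 < complex.Re s -> regular G s.
Proof.
move=> s0; apply: sG_regular; first by apply: contraTneq s0 => ->; rewrite ltxx.
move=> i j; have [[h _ _] _] := hF.
have hd : derivable (feval (F i j)) s 1.
  have := h i j s s0; rewrite (_ : (fun z => _) = feval (F i j))//.
  by apply/funext => z; rewrite mxE.
exact: feval_regular (derivable_cvg_dnbhs hd).
Qed.

(* The factor (z - z)^m is 1 for m = 0 and 0 for m > 0. *)
Lemma residue_G z m : 'Re z = 0 -> exists2 A : 'M[R[i]]_n, psd A & forall i j,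
  (s - z) ^+ m.+1 * (s * feval (G i j) s) @[s --> z^'] --> (z - z) ^+ m * A i j.
Proof.
move=> rez; have [[_ _ hpos] _] := hF.
have [A pA hA] := simple_pole_psd rez hpos; exists A; [exact: pA|move=> i j].
have cs : s @[s --> z^'] --> z by exact: dnbhs_cvg.
have -> : (z - z) ^+ m * A i j =
    (z - z) ^+ m * (A i j + (z - z) * (z * (at_infty G i j)%:C)).
  by rewrite [X in A i j + X * _]subrr mul0r addr0.
apply: (cvg_near_eq (f := fun s => (s - z) ^+ m * ((s - z) * feval (F i j) s
    + (s - z) * (s * (at_infty G i j)%:C)))).
  apply: filterS (near_feval_sG G i j z) => s ->.
  by rewrite -mulrDr -mulrDr subrK exprSr mulrA.
exact: (cvgM (cvg_exprn (k := m) (cvgB cs (cvg_cst _)))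
  (cvgD (hA i j) (cvgM (cvgB cs (cvg_cst _)) (cvgM cs (cvg_cst _))))).
Qed.

(** Converse of [sG_skew]: the symmetric G(oo) cancels in the relation for s(G - G(oo)), leaving i w
    times the difference of G and its conjugate transpose, and i w is nonzero. *)
Lemma sG_skew_hermitian (w : R) : 0 < w -> regular G (w *i) ->
  'i%C *: (mxeval G (w *i) - (mxeval G (w *i))^t*) = 0.
Proof.
move=> w0 Gw; have [_ /(_ w w0)] := hF.
have wi0 : (w *i : R[i]) != 0 by rewrite eq_complex /= eqxx gt_eqF.
have E k l : mxeval F (w *i) k l = w *i * (mxeval G (w *i) k l - (at_infty G k l)%:C).
  by rewrite [LHS]mxE feval_sG// [in RHS]mxE.
have nF : ~ is_pole F (w *i) by apply/regularP; exact: regular_sG.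
move=> /(_ nF)/matrixP; move: (mxeval F (w *i)) (mxeval G (w *i)) E => M N E MN.
suff /eqP : N = N^t* by rewrite -subr_eq0 => /eqP ->; rewrite scaler0.
apply/matrixP => i j; have := MN i j; rewrite !mxE !E rmorphM rmorphB /= conj_imag.
have cR : (at_infty G j i)%:C \is Num.real by apply/complex_realP; exists (at_infty G j i).
rewrite (conj_Creal cR).
have /matrixP/(_ i j) := sym; rewrite mxE => <-.
rewrite mulNr -mulrBr => /eqP; rewrite mulf_eq0 (negPf wi0) /= opprB addrA subrK.
by rewrite subr_eq0 => /eqP.
Qed.

Lemma positive_real_negative_imaginary : lossless_negative_imaginary G.
Proof.
split; last by move=> w w0 /regularP Gw; exact: sG_skew_hermitian.
split.
- by move=> s s0; apply/regularP; exact: positive_real_regular.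
- by move=> w w0 /regularP Gw; rewrite sG_skew_hermitian//; exact: psd0.
- move=> _.
  (* At z = 0 the factor s raises the exponent to m + 2: m = 0 gives the limit of s^2 G, and m > 0
     the zero limits for exponents at least 3. *)
  have h m : exists2 A : 'M[R[i]]_n, psd A & forall i j,
      s ^+ m.+2 * feval (G i j) s @[s --> (0 : R[i])^'] --> 0 ^+ m * A i j.
    have re0 : 'Re (0 : R[i]) = 0 by exact: raddf0.
    have [A pA hA] := residue_G m re0; exists A; [exact: pA|move=> i j].
    have := hA i j; rewrite subr0.
    by apply: cvg_near_eq; apply: nearW => s; rewrite subr0 mulrA -exprSr.
  have mx m (A : 'M[R[i]]_n) : (forall i j,
      s ^+ m * feval (G i j) s @[s --> (0 : R[i])^'] --> A i j) ->
      s ^+ m *: mxeval G s @[s --> (0 : R[i])^'] --> A.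
    move=> hA; apply: cvg_mx_entry => i j.
    apply: (cvg_near_eq (f := fun s => s ^+ m * feval (G i j) s)); last exact: hA.
    by apply: nearW => s; rewrite !mxE.
  have [A pA hA] := h 0%N.
  have hA' i j : s ^+ 2 * feval (G i j) s @[s --> (0 : R[i])^'] --> A i j.
    by have := hA i j; rewrite expr0 mul1r.
  split.
  + apply/pole_order_leP => i j; apply: (@mup_feval _ _ _ _ (A i j)).
    apply: (cvg_near_eq (f := fun s => s ^+ 2 * feval (G i j) s)); last exact: hA'.
    by apply: nearW => s; rewrite subr0.
  + by exists A; [exact: mx|exact: pA].
  + move=> m m3; apply: mx => i j; rewrite mxE.
    have [B _ /(_ i j)] := h m.-2.
    have -> : m.-2.+2 = m by case: m m3 => [|[|]].
    have -> : 0 ^+ m.-2 = 0 :> R[i] by rewrite expr0n; case: m m3 => [|[|[|]]].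
    by rewrite mul0r => hB; exact: hB.
- move=> w w0 _.
  have rew : 'Re (w *i : R[i]) = 0 by rewrite -complexRe.
  have wi0 : (w *i : R[i]) != 0 by rewrite eq_complex /= eqxx gt_eqF.
  have [A pA hA] := residue_G 0 rew.
  have cs : s @[s --> (w *i : R[i])^'] --> (w *i : R[i]) by exact: dnbhs_cvg.
  have hA' i j : (s - w *i) * feval (G i j) s @[s --> (w *i : R[i])^'] --> A i j / w *i.
    have h1 := hA i j; rewrite expr0 mul1r in h1.
    apply: (cvg_near_eq (f := fun s => (s - w *i) ^+ 1 * (s * feval (G i j) s) / s)).
      apply: filterS (near_dnbhs_neq0 (w *i)) => s s0.
      by rewrite expr1 [s * _]mulrC mulrA mulfK.
    exact: (cvgM h1 (cvgV wi0 cs)).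
  split.
    apply/pole_order_leP => i j; apply: (@mup_feval _ _ _ _ (A i j / w *i)).
    apply: (cvg_near_eq (f := fun s => (s - w *i) * feval (G i j) s)); last exact: hA'.
    by apply: nearW => s; rewrite expr1.
  (* The residue of G at i w is A/(i w), so that of i G is A/w. *)
  exists (w^-1%:C *: A); last by apply: psdZ => //; rewrite invr_ge0 ltW.
  apply: cvg_mx_entry => i j; rewrite mxE.
  have -> : w^-1%:C * A i j = 'i%C * (A i j / w *i).
    rewrite imagE complexiE invfM fmorphV /=.
    by rewrite [RHS]mulrCA mulVKf ?neq0Ci// mulrC.
  apply: (cvg_near_eq (f := fun s => 'i%C * ((s - w *i) * feval (G i j) s))).
    by apply: nearW => s; rewrite !mxE mulrCA.
  exact: (cvgM (cvg_cst _) (hA' i j)).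
(* Properness makes every truncated difference of sizes 0, so there is no pole at infinity. *)
- have p0 : (pole_order_infty G <= 0)%N.
    apply/bigmax_leqP => i _; apply/bigmax_leqP => j _.
    by rewrite leqn0 subn_eq0.
  by rewrite /is_pole_infty ltnNge p0.
Qed.

End backward.

Theorem lemma8 (R : realType) (n : nat) (G : 'M[{fraction {poly R}}]_n)
    (hG : is_proper G) :
  lossless_negative_imaginary G <->
  at_infty G = (at_infty G)^T /\ lossless_positive_real (sG_sub_infty G).
Proof.
split=> [hL|[sym hF]]; last exact: positive_real_negative_imaginary.
by split; [exact: lossless_at_infty_sym|exact: sG_lossless_positive_real].
Qed.
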